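(* Assume $\Delta t<1$. Then the fully discrete scheme (FD) defined in the context is unconditionally stable in the following sense: there is a constant $C>0$ independent of $h$ and $\Delta t$ such that for $J=1,2,\dots,M$, $$\|\boldsymbol v_h^J\|_c^2+\|\sigma_h^J\|_a^2\le C\left(\|\sigma_h^0\|_a^2+\|\boldsymbol v_h^0\|_c^2+\|\boldsymbol f\|_{L^\infty(L^2)}^2\right).$$
   Context: Setting. $d\in\{2,3\}$, $\Omega\subset\mathbb R^d$ is a bounded convex polyhedral domain, $T>0$. $\|\cdot\|_0$ is the $L^2(\Omega)$ norm and $(\cdot,\cdot)$ the $L^2$ inner product; $\|\cdot\|_{L^\infty(L^2)}$ is the norm of $L^\infty([0,T];L^2(\Omega)^d)$. $\rho(\boldsymbol x)$ is a scalar function with $0<\rho_0\le\rho\le\rho_1<\infty$ a.e. in $\Omega$; $\mathbb C=\mathbb C(\boldsymbol x)$ is a rank 4 symmetric tensor with $M_0\,\tau:\tau\le\mathbb C^{-1}\tau:\tau\le M_1\,\tau:\tau$ for all symmetric $\tau\in\mathbb R^{d\times d}$ and a.e. $\boldsymbol x$, where $M_0,M_1>0$ and $\sigma:\tau=\sum_{i,j}\sigma_{ij}\tau_{ij}$. $\boldsymbol f\in C^0([0,T],L^2(\Omega)^d)$. $H(\mathbf{div},\Omega,S)=\{\tau\in L^2(\Omega)^{d\times d}:\tau_{ij}=\tau_{ji},\ \mathbf{div}\,\tau\in L^2(\Omega)^d\}$ (row-wise divergence), $\|\tau\|_{\mathbf{div}}^2=\|\tau\|_0^2+\|\mathbf{div}\,\tau\|_0^2$.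 Define $a(\sigma,\tau)=\int_\Omega\mathbb C^{-1}\sigma:\tau\,d\boldsymbol x$, $b(\boldsymbol v,\tau)=\int_\Omega\boldsymbol v\cdot\mathbf{div}\,\tau\,d\boldsymbol x$, $c(\boldsymbol v,\boldsymbol w)=\int_\Omega\rho\,\boldsymbol v\cdot\boldsymbol w\,d\boldsymbol x$, $\|\tau\|_a^2=a(\tau,\tau)$, $\|\boldsymbol w\|_c^2=c(\boldsymbol w,\boldsymbol w)$. Discretization. $\mathcal T_h$ is a shape regular partition of $\Omega$ into triangles/tetrahedra or rectangles/cuboids, $h$ the maximal element diameter. $\mathrm H_h\subset H(\mathbf{div},\Omega,S)$ and $\mathrm V_h\subset L^2(\Omega)^d$ are finite-dimensional spaces on $\mathcal T_h$ satisfying the discrete inf-sup condition: there is $C>0$ independent of $h$ with $\|\boldsymbol w_h\|_0\le C\sup_{0\ne\tau_h\in\mathrm H_h}b(\boldsymbol w_h,\tau_h)/\|\tau_h\|_{\mathbf{div}}$ for all $\boldsymbol w_h\in\mathrm V_h$. Time grid: $t_i=i\Delta t$, $i=0,\dots,M$, $\Delta t=T/M$. For a function (or sequence) $\varphi$: $\varphi^n=\varphi(t_n)$, $\varphi^{n+1/2}=(\varphi^n+\varphi^{n+1})/2$, $\Delta_t\varphi^{n+1/2}=(\varphi^{n+1}-\varphi^n)/\Delta t$. (FD) Crank-Nicolson fully discrete scheme: for $0\le n\le M-1$ find $(\sigma_h^{n+1},\boldsymbol v_h^{n+1})\in\mathrm H_h\times\mathrm V_h$ with $a(\Delta_t\sigma_h^{n+1/2},\tau_h)+a(\sigma_h^{n+1/2},\tau_h)+b(\boldsymbol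 v_h^{n+1/2},\tau_h)=0$ for all $\tau_h\in\mathrm H_h$, $c(\Delta_t\boldsymbol v_h^{n+1/2},\boldsymbol w_h)-b(\boldsymbol w_h,\sigma_h^{n+1/2})=(\boldsymbol f^{n+1/2},\boldsymbol w_h)$ for all $\boldsymbol w_h\in\mathrm V_h$, with initial data $\sigma_h^0=I_{\mathrm H_h}\psi_0\in\mathrm H_h$, $\boldsymbol v_h^0=I_{\mathrm V_h}\phi_1\in\mathrm V_h$, where $\psi_0\in H(\mathbf{div},\Omega,S)$ and $\phi_1\in L^2(\Omega)^d$ are given initial data and $I_{\mathrm H_h}:H(\mathbf{div},\Omega,S)\to\mathrm H_h$, $I_{\mathrm V_h}:L^2(\Omega)^d\to\mathrm V_h$ are interpolation operators satisfying, with $C$ independent of $h$ and an integer $l\ge0$, $\|\psi_0-I_{\mathrm H_h}\psi_0\|_0\le Ch^l\|\psi_0\|_l$ and $\|\phi_1-I_{\mathrm V_h}\phi_1\|_0\le Ch^l\|\phi_1\|_l$ when $\psi_0\in H^l(\Omega)^{d\times d}$, $\phi_1\in H^l(\Omega)^d$ ($\|\cdot\|_l$ the $H^l(\Omega)$ norm). *)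

(* Defs.v *)
From HB Require Import structures.
From mathcomp Require Import all_boot all_order all_algebra.
From mathcomp Require Import all_classical all_reals all_analysis.
From mathcomp Require Import ess_sup_inf.
Set Implicit Arguments.
Unset Strict Implicit.
Unset Printing Implicit Defensive.
Import Order.TTheory GRing.Theory Num.Theory.
Import numFieldNormedType.Exports.
Local Open Scope classical_set_scope.
Local Open Scope ring_scope.

(* R^n is 'rV[R]_n with the product (= Borel) sigma-algebra; Lebesgue measure on
   R^n.+1 is the image of the product measure under (t, v) |-> (t, v_0, ...).
   The norm of 'rV[R]_n in the library is the sup norm, hence enorm below. *)
Section measurable_rV.
Context (R : realType) (n : nat).
Let coords : 'I_n -> 'rV[R]_n -> R := fun i x => x ord0 i.

Let rV_set0 : g_sigma_preimage coords set0.
Proof. exact: sigma_algebra0. Qed.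
Let rV_setC A : g_sigma_preimage coords A -> g_sigma_preimage coords (~` A).
Proof. exact: sigma_algebraC. Qed.
Let rV_bigcup (F : _^nat) : (forall i, g_sigma_preimage coords (F i)) ->
  g_sigma_preimage coords (\bigcup_i (F i)).
Proof. exact: sigma_algebra_bigcup. Qed.

HB.instance Definition _ := @isMeasurable.Build
  (measure_tuple_display default_measure_display) 'rV[R]_n
  (g_sigma_preimage coords) rV_set0 rV_setC rV_bigcup.

Lemma measurable_coord (i : 'I_n) :
  measurable_fun [set: 'rV[R]_n] (fun x => x ord0 i : R).
Proof.
move=> _ Y mY; rewrite setTI; apply: sub_sigma_algebra => /=.
rewrite -bigcup_seq/=; exists i => /=; first by rewrite mem_index_enum.
by exists Y => //; rewrite setTI.
Qed.

Lemma measurable_fun_rVP d (T : measurableType d) (f : T -> 'rV[R]_n) :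
  (forall i, measurable_fun setT (fun t => f t ord0 i : R)) ->
  measurable_fun setT f.
Proof.
move=> mf.
suff H : g_sigma_preimage (fun i t => f t ord0 i) `<=` measurable.
  move=> _ A mA; apply: H.
  rewrite (@g_sigma_preimage_comp _ _ n _ (fun i (x : 'rV[R]_n) => x ord0 i) _ f).
  by exists A.
apply: smallest_sub; first exact: sigma_algebra_measurable.
case: n f mf => [|m] f mf; first by rewrite big_ord0.
rewrite -bigcup_mkord_ord; apply: bigcup_sub => i Ii.
by move=> A [B mB <-]; exact: mf.
Qed.
End measurable_rV.

Section lebesgue_rV.
Context (R : realType).

Definition rV_cons (n : nat) (p : measurableTypeR R * 'rV[R]_n) : 'rV[R]_n.+1 :=
  row_mx (p.1 : R)%:M p.2.

Lemma measurable_rV_cons n : measurable_fun setT (@rV_cons n).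
Proof.
apply: measurable_fun_rVP => i; rewrite /rV_cons.
have [j ->|j ->] := split_ordP (i : 'I_(1 + n)).
  rewrite (_ : (fun _ => _) = fst)//; apply/funext => p.
  by rewrite (@row_mxEl R 1 1 n) mxE !ord1 eqxx mulr1n.
rewrite (_ : (fun _ => _) = (fun x : 'rV[R]_n => x ord0 j) \o snd).
  by apply: measurableT_comp => //; exact: measurable_coord.
by apply/funext => p; rewrite (@row_mxEr R 1 1 n).
Qed.

HB.instance Definition _ n := @isMeasurableFun.Build _ _ _ _ (@rV_cons n)
  (@measurable_rV_cons n).

Section pushforward_cons.
Context (n : nat) (mu : {sigma_finite_measure set 'rV[R]_n -> \bar R}).

Definition lebesgue_cons : set 'rV[R]_n.+1 -> \bar R :=
  pushforward (@lebesgue_measure R \x mu)%E (@rV_cons n).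

Let lebesgue_cons0 : lebesgue_cons set0 = 0%E.
Proof. exact: measure0. Qed.

Let lebesgue_cons_ge0 A : (0 <= lebesgue_cons A)%E.
Proof. exact: measure_ge0. Qed.

Let lebesgue_cons_sigma_additive : semi_sigma_additive lebesgue_cons.
Proof. exact: measure_semi_sigma_additive. Qed.

HB.instance Definition _ := isMeasure.Build _ _ _ lebesgue_cons
  lebesgue_cons0 lebesgue_cons_ge0 lebesgue_cons_sigma_additive.

Let lebesgue_cons_sigma_finite : sigma_finite setT lebesgue_cons.
Proof.
have [F FT mF] : sigma_finite setT (@lebesgue_measure R \x mu)%E.
  have /sigma_finiteP[F [TF ndF Foo]] := sigma_finiteT (@lebesgue_measure R).
  have /sigma_finiteP[G [TG ndG Goo]] := sigma_finiteT mu.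
  exists (fun k => F k `*` G k).
    rewrite -setXTT TF TG predeqE => -[x y]; split.
      move=> [/= [k _ Fkx] [l _ Gly]]; exists (maxn k l) => //; split.
      - by move: x Fkx; exact/subsetPset/ndF/leq_maxl.
      - by move: y Gly; exact/subsetPset/ndG/leq_maxr.
    by move=> [k _ []/= ? ?]; split; exists k.
  move=> k; have [? ?] := Foo k; have [? ?] := Goo k.
  split; first exact: measurableX.
  by rewrite product_measure1E// lte_mul_pinfty// ge0_fin_numE.
pose g (x : 'rV[R]_n.+1) : measurableTypeR R * 'rV[R]_n :=
  (x ord0 ord0, rsubmx (x : 'rV[R]_(1 + n))).
have gK : cancel (@rV_cons n) g.
  move=> [a v]; rewrite /g /rV_cons/= row_mxKr; congr pair.
  have -> : (ord0 : 'I_(1 + n)) = lshift n (ord0 : 'I_1) by apply: val_inj.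
  by rewrite (@row_mxEl R 1 1 n) mxE eqxx mulr1n.
have mg : measurable_fun setT g.
  apply/measurable_fun_pairP; split.
    exact: measurable_coord.
  apply: measurable_fun_rVP => i.
  rewrite (_ : (fun _ => _) = fun x : 'rV[R]_(1 + n) => x ord0 (rshift 1 i)).
    exact: (@measurable_coord R n.+1 (rshift 1 i)).
  by apply/funext => x; rewrite /= mxE.
exists (fun k => g @^-1` F k); first by rewrite -preimage_bigcup -FT preimage_setT.
move=> k; have [mFk Fk] := mF k; split.
  by rewrite -[X in measurable X]setTI; exact: mg.
rewrite /lebesgue_cons /pushforward -comp_preimage.
by rewrite (_ : g \o _ = id)//; apply/funext => p; exact: gK.
Qed.

HB.instance Definition _ := Measure_isSigmaFinite.Build _ _ _ lebesgue_cons
  lebesgue_cons_sigma_finite.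
End pushforward_cons.

Fixpoint lebesgue_rV (n : nat) : {sigma_finite_measure set 'rV[R]_n -> \bar R} :=
  match n with
  | 0 => \d_(0 : 'rV[R]_0)
  | m.+1 => lebesgue_cons (lebesgue_rV m)
  end.
End lebesgue_rV.

Lemma lebesgue_rV_box (R : realType) (n : nat) (a b : 'rV[R]_n) :
  (forall i, a ord0 i <= b ord0 i) ->
  lebesgue_rV R n [set x | forall i, a ord0 i < x ord0 i <= b ord0 i] =
  (\prod_(i < n) (b ord0 i - a ord0 i))%:E.
Proof.
elim: n a b => [|n IHn] a b ab.
  by rewrite big_ord0 /= diracE mem_set// => -[].
pose a' : 'rV[R]_n := \row_i a ord0 (lift ord0 i).
pose b' : 'rV[R]_n := \row_i b ord0 (lift ord0 i).
rewrite big_ord_recl EFinM /= /lebesgue_cons /pushforward.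
have mbox : measurable [set y : 'rV[R]_n |
    forall i, a' ord0 i < y ord0 i <= b' ord0 i].
  rewrite (_ : [set _ | _] = \big[setI/setT]_(i < n)
      ((fun y : 'rV[R]_n => y ord0 i : R) @^-1` `]a' ord0 i, b' ord0 i])).
    apply: bigsetI_measurable => i _.
    by rewrite -[X in measurable X]setTI; apply: measurable_coord.
  rewrite -bigcap_seq; apply/seteqP; split => y /= Hy i.
    by move=> _; rewrite /= in_itv /= Hy.
  by have := Hy i; rewrite /= in_itv /=; apply; rewrite mem_index_enum.
pose B : set (measurableTypeR R * 'rV[R]_n) := `]a ord0 ord0, b ord0 ord0] `*`
    [set y : 'rV[R]_n | forall i, a' ord0 i < y ord0 i <= b' ord0 i].
transitivity ((@lebesgue_measure R \x lebesgue_rV R n)%E B).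
  congr (_ _).
  have e0 p : @rV_cons R n p ord0 ord0 = p.1.
    rewrite /rV_cons (_ : ord0 = lshift n (ord0 : 'I_1)); last exact: val_inj.
    by rewrite (@row_mxEl R 1 1 n) mxE !ord1 eqxx mulr1n.
  have eS p i : @rV_cons R n p ord0 (lift ord0 i) = p.2 ord0 i.
    rewrite /rV_cons (_ : lift ord0 i = rshift 1 i); last exact: val_inj.
    by rewrite (@row_mxEr R 1 1 n).
  apply/seteqP; split => -[t y] /=.
    move=> H; split; first by have := H ord0; rewrite e0 => h; exact: h.
    by move=> i; have := H (lift ord0 i); rewrite eS !mxE.
  move=> [Ht Hy] i; have [j ->|->] := unliftP ord0 i.
    by rewrite eS; have := Hy j; rewrite !mxE.
  by rewrite e0 /=; exact: Ht.
rewrite /B product_measure1E//; congr (_ * _)%E.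
  transitivity (@lebesgue_measure R `]a ord0 ord0, b ord0 ord0]) => //.
  rewrite lebesgue_measure_itv /= lte_fin.
  move: (ab ord0); rewrite le_eqVlt => /orP[/eqP->|->]; last by rewrite EFinB.
  by rewrite ltxx subrr.
rewrite IHn; first by congr EFin; apply: eq_bigr => i _; rewrite !mxE.
by move=> i; rewrite !mxE.
Qed.

Section euclidean.
Context (R : realType).

(* Entrywise product: u . v on row vectors, sigma : tau on matrices. *)
Definition mxdot (m n : nat) (A B : 'M[R]_(m, n)) : R :=
  \sum_i \sum_j A i j * B i j.

Definition enorm (n : nat) (x : 'rV[R]_n) : R := Num.sqrt (mxdot x x).

Definition convex_polyhedral_domain (d : nat) (Om : set 'rV[R]_d) : Prop :=
  [/\ Om !=set0, bounded_set Om &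
    exists (k : nat) (nu : 'I_k -> 'rV[R]_d) (c : 'I_k -> R),
      Om = [set x | forall i, mxdot (nu i) x < c i]].

Definition diam (d : nat) (K : set 'rV[R]_d) : R :=
  sup [set r | exists x y, [/\ K x, K y & r = enorm (x - y)]].

Definition indiam (d : nat) (K : set 'rV[R]_d) : R :=
  sup [set r | 0 <= r /\
    exists x, [set y | enorm (y - x) <= r / 2] `<=` K].

(* Triangles for d = 2, tetrahedra for d = 3. *)
Definition simplex (d : nat) (K : set 'rV[R]_d) : Prop :=
  exists p : 'I_d.+1 -> 'rV[R]_d,
    (forall l : 'I_d.+1 -> R, \sum_k l k = 0 -> \sum_k l k *: p k = 0 ->
       forall k, l k = 0) /\
    K = [set x | exists l : 'I_d.+1 -> R,
      [/\ forall k, 0 <= l k, \sum_k l k = 1 & x = \sum_k l k *: p k]].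

(* Rectangles for d = 2, cuboids for d = 3; the rows of Q are the directions of
   the edges, which need not be parallel to the axes. *)
Definition cuboid (d : nat) (K : set 'rV[R]_d) : Prop :=
  exists (a b : 'rV[R]_d) (Q : 'M[R]_d),
    [/\ Q *m Q^T = 1%:M, forall i, 0 < b ord0 i &
      K = [set x | exists s : 'rV[R]_d,
        (forall i, 0 <= s ord0 i <= b ord0 i) /\ x = a + s *m Q]].

Definition mesh (d : nat) (Om : set 'rV[R]_d) (Th : set (set 'rV[R]_d)) : Prop :=
  [/\ finite_set Th,
      (forall K, Th K -> simplex K) \/ (forall K, Th K -> cuboid K),
      \bigcup_(K in Th) K = closure Om &
      forall K L, Th K -> Th L -> K <> L ->
        interior K `&` interior L = set0].

Definition mesh_size (d : nat) (Th : set (set 'rV[R]_d)) : R :=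
  sup [set diam K | K in Th].

Definition shape_regular (d : nat) (I : Type)
    (Th : I -> set (set 'rV[R]_d)) : Prop :=
  exists2 kappa : R, 0 < kappa &
    forall i K, Th i K -> diam K <= kappa * indiam K.

End euclidean.

Section elasticity_tensors.
Context (R : realType) (d : nat).

Definition tensor4 := 'I_d -> 'I_d -> 'I_d -> 'I_d -> R.

Definition tensor_sym (C : tensor4) : Prop :=
  forall i j k l, C i j k l = C j i k l /\ C i j k l = C k l i j.

Definition tensor_app (C : tensor4) (tau : 'M[R]_d) : 'M[R]_d :=
  \matrix_(i, j) \sum_k \sum_l C i j k l * tau k l.

(* The inverse is taken on symmetric matrices; it is unique among symmetric
   tensors, and is 0 if C is not invertible there. *)
Definition tensor_inv (C : tensor4) : tensor4 :=
  xget (fun _ _ _ _ => 0) [set A | tensor_sym A /\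
    forall tau : 'M[R]_d, tau^T = tau ->
      tensor_app A (tensor_app C tau) = tau /\
      tensor_app C (tensor_app A tau) = tau].

End elasticity_tensors.

(* Elements of L^2 are represented by functions on R^d, of which only the a.e.
   values in Om matter. *)
Section function_spaces.
Context (R : realType) (d : nat) (Om : set 'rV[R]_d).

Local Notation mu := (lebesgue_rV R d).
Local Notation field m n := ('rV[R]_d -> 'M[R]_(m, n)).

Definition L2 (m n : nat) (u : field m n) : Prop :=
  forall i j, measurable_fun Om (fun x => u x i j) /\
    mu.-integrable Om (fun x => ((u x i j) ^+ 2)%:E).

Definition L2dot (m n : nat) (u v : field m n) : R :=
  \int[mu]_(x in Om) mxdot (u x) (v x).

Definition L2norm (m n : nat) (u : field m n) : R := Num.sqrt (L2dot u u).

Definition eq_ae (m n : nat) (u v : field m n) : Prop :=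
  \forall x \ae mu, Om x -> u x = v x.

Definition partial (i : 'I_d) (phi : 'rV[R]_d -> R) : 'rV[R]_d -> R :=
  fun x => 'D_(delta_mx ord0 i) phi x.

Definition partials (s : seq 'I_d) (phi : 'rV[R]_d -> R) : 'rV[R]_d -> R :=
  foldr partial phi s.

(* C_c^infty(Om). *)
Definition test_function (phi : 'rV[R]_d -> R) : Prop :=
  [/\ forall s, continuous (partials s phi),
      forall s i x, derivable (partials s phi) x (delta_mx ord0 i),
      compact (closure [set x | phi x != 0]) &
      closure [set x | phi x != 0] `<=` Om].

(* g is the row-wise weak divergence of tau. *)
Definition is_wdiv (tau : field d d) (g : field 1 d) : Prop :=
  L2 g /\ forall phi, test_function phi -> forall i,
    \int[mu]_(x in Om) (\sum_j tau x i j * partial j phi x) =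
    - \int[mu]_(x in Om) (g x ord0 i * phi x).

Definition wdiv (tau : field d d) : field 1 d :=
  xget (fun=> 0) [set g | is_wdiv tau g].

Definition Hdiv (tau : field d d) : Prop :=
  [/\ L2 tau,
      forall i j, \forall x \ae mu, Om x -> tau x i j = tau x j i &
      exists g, is_wdiv tau g].

Definition Hdiv_norm (tau : field d d) : R :=
  Num.sqrt (L2norm tau ^+ 2 + L2norm (wdiv tau) ^+ 2).

Section sobolev.
Variable l : nat.

Definition multi_index := {ffun 'I_d -> 'I_l.+1}.

Definition mdeg (al : multi_index) : nat := (\sum_i al i)%N.

Definition mpartial (al : multi_index) (phi : 'rV[R]_d -> R) :=
  partials (flatten [seq nseq (al i) i | i <- enum 'I_d]) phi.

Definition is_wpartial (m n : nat) (al : multi_index) (u g : field m n) : Prop :=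
  L2 g /\ forall phi, test_function phi -> forall i j,
    \int[mu]_(x in Om) (u x i j * mpartial al phi x) =
    (-1) ^+ mdeg al * \int[mu]_(x in Om) (g x i j * phi x).

Definition wpartial (m n : nat) (al : multi_index) (u : field m n) : field m n :=
  xget (fun=> 0) [set g | is_wpartial al u g].

Definition Hl (m n : nat) (u : field m n) : Prop :=
  L2 u /\ forall al : multi_index, (mdeg al <= l)%N ->
    exists g, is_wpartial al u g.

Definition Hl_norm (m n : nat) (u : field m n) : R :=
  Num.sqrt (\sum_(al : multi_index | (mdeg al <= l)%N)
    L2norm (wpartial al u) ^+ 2).

End sobolev.

Definition findim_space (m n : nat) (V : set (field m n)) : Prop :=
  [/\ V 0,
      forall (a : R) u v, V u -> V v -> V (a *: u + v) &
      exists (k : nat) (e : 'I_k -> field m n), (forall j, V (e j)) /\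
        forall u, V u -> exists c : 'I_k -> R, eq_ae u (\sum_j c j *: e j)].

(* P : D -> V is an operator on classes of functions modulo equality a.e. *)
Definition operator_into (m n : nat) (D V : set (field m n))
    (P : field m n -> field m n) : Prop :=
  (forall u, D u -> V (P u)) /\
  (forall u v, D u -> D v -> eq_ae u v -> eq_ae (P u) (P v)).

Definition C0_L2 (m n : nat) (T : R) (f : R -> field m n) : Prop :=
  (forall t, 0 <= t <= T -> L2 (f t)) /\
  (forall t, 0 <= t <= T ->
     (fun s => L2norm (f s - f t)) @ within `[0, T] (nbhs t) --> (0 : R)).

Definition Linf_L2_norm (m n : nat) (T : R) (f : R -> field m n) : R :=
  fine (ess_sup
    (mrestr (@lebesgue_measure R) (measurable_itv `[0, T]))
    (fun t => (L2norm (f t))%:E)).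

End function_spaces.
Arguments L2 {R d} Om {m n} u.

Section forms.
Context (R : realType) (d : nat) (Om : set 'rV[R]_d).
Context (rho : 'rV[R]_d -> R) (C : 'rV[R]_d -> tensor4 R d).

Local Notation mu := (lebesgue_rV R d).
Local Notation vfield := ('rV[R]_d -> 'rV[R]_d).
Local Notation tfield := ('rV[R]_d -> 'M[R]_d).

Definition form_a (sigma tau : tfield) : R :=
  \int[mu]_(x in Om) mxdot (tensor_app (tensor_inv (C x)) (sigma x)) (tau x).

Definition form_b (v : vfield) (tau : tfield) : R :=
  \int[mu]_(x in Om) mxdot (v x) (wdiv Om tau x).

Definition form_c (v w : vfield) : R :=
  \int[mu]_(x in Om) (rho x * mxdot (v x) (w x)).

Definition norm_a (tau : tfield) : R := Num.sqrt (form_a tau tau).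

Definition norm_c (w : vfield) : R := Num.sqrt (form_c w w).

Definition inf_sup (Hh : set tfield) (Vh : set vfield) (K : R) : Prop :=
  forall w, Vh w ->
    L2norm Om w <= K * sup [set r | exists tau, [/\ Hh tau,
      ~ eq_ae Om tau 0 & r = form_b w tau / Hdiv_norm Om tau]].

Definition midpoint (V : lmodType R) (phi : nat -> V) (n : nat) : V :=
  2^-1 *: (phi n + phi n.+1).

Definition diffquot (V : lmodType R) (dt : R) (phi : nat -> V) (n : nat) : V :=
  dt^-1 *: (phi n.+1 - phi n).

(* dt = T / M is the time step and fn n = f(t_n). *)
Definition crank_nicolson (dt : R) (M : nat) (fn : nat -> vfield)
    (Hh : set tfield) (Vh : set vfield)
    (sigma : nat -> tfield) (v : nat -> vfield) : Prop :=
  (forall n, (n <= M)%N -> Hh (sigma n) /\ Vh (v n)) /\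
  (forall n, (n < M)%N ->
    (forall tau, Hh tau ->
       form_a (diffquot dt sigma n) tau + form_a (midpoint sigma n) tau
         + form_b (midpoint v n) tau = 0) /\
    (forall w, Vh w ->
       form_c (diffquot dt v n) w - form_b w (midpoint sigma n) =
       L2dot Om (midpoint fn n) w)).

End forms.

(* Main.v *)
Require Import Defs.
From HB Require Import structures.
From mathcomp Require Import all_boot all_order all_algebra.
From mathcomp Require Import all_classical all_reals all_analysis.
From mathcomp Require Import ess_sup_inf measurable_realfun.
From mathcomp Require Import ring lra.
Set Implicit Arguments.
Unset Strict Implicit.
Unset Printing Implicit Defensive.
Import Order.TTheory GRing.Theory Num.Theory.
Import numFieldNormedType.Exports.
Local Open Scope classical_set_scope.
Local Open Scope ring_scope.

(** The scheme is tested with its own midpoints: tau = sigma^{n+1/2} and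
    w = v^{n+1/2}. The coupling terms b(v^{n+1/2}, sigma^{n+1/2}) then cancel,
    and since a and c are symmetric, the difference quotients become
    differences of energies: with E_n = ||v^n||_c^2 + ||sigma^n||_a^2,
      E_{n+1} - E_n + 2 dt a(sigma^{n+1/2}, sigma^{n+1/2})
        = 2 dt (f^{n+1/2}, v^{n+1/2}).
    The dissipation is nonnegative, and Young's inequality with weight rho0
    ([L2dot_midpoint_le]) bounds the load by dt ((E_n + E_{n+1}) / 2 + G),
    where G = ||f||^2 / rho0. As dt < 1, the implicit term can be moved to the
    left at the price of a growth factor 1 + 2 dt per step, so that
    E_J + G <= exp(2 T) (E_0 + G) ([crank_nicolson_gronwall]); hence the
    constant exp(2 T) (1 + 1 / rho0), in which the mesh does not enter.

    What remains is to justify the manipulation of the integrals.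
    - The integrands of a must be measurable, although C^{-1} is only given
      pointwise as a chosen inverse. By Cramer's rule its entries are rational
      functions of the entries of C ([tensor_inv_cramer],
      [measurable_tensor_inv]). The bounds on C^{-1} and rho then give
      integrability on L^2.
    - The nodal values f(t_n) must be controlled by an essential supremum in
      time. As t |-> ||f(t)|| is continuous on [0, T], it is bounded there,
      and it exceeds none of its almost everywhere bounds
      ([within_continuous_le_ess_sup], [L2norm_le_Linf]). *)

(** * The entrywise inner product of matrices *)

Section mxdot_theory.
Context (R : realType) (m n : nat).
Implicit Types A B D : 'M[R]_(m, n).

Lemma mxdotC A B : mxdot A B = mxdot B A.
Proof. by apply: eq_bigr => i _; apply: eq_bigr => j _; rewrite mulrC. Qed.

Lemma mxdotDl A B D : mxdot (A + B) D = mxdot A D + mxdot B D.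
Proof.
rewrite -big_split; apply: eq_bigr => i _; rewrite -big_split.
by apply: eq_bigr => j _; rewrite mxE mulrDl.
Qed.

Lemma mxdotZl a A B : mxdot (a *: A) B = a * mxdot A B.
Proof.
rewrite mulr_sumr; apply: eq_bigr => i _; rewrite mulr_sumr.
by apply: eq_bigr => j _; rewrite mxE mulrA.
Qed.

Lemma mxdotDr A B D : mxdot A (B + D) = mxdot A B + mxdot A D.
Proof. by rewrite mxdotC mxdotDl !(mxdotC A). Qed.

Lemma mxdotZr a A B : mxdot A (a *: B) = a * mxdot A B.
Proof. by rewrite mxdotC mxdotZl (mxdotC A). Qed.

Lemma mxdot_ge0 A : 0 <= mxdot A A.
Proof. by apply: sumr_ge0 => i _; apply: sumr_ge0 => j _; rewrite -expr2 sqr_ge0. Qed.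

Lemma mxdot_delta A i j : mxdot A (delta_mx i j) = A i j.
Proof.
rewrite /mxdot (bigD1 i)//= (bigD1 j)//= big1 => [|k kj].
  rewrite big1 => [|k ki]; first by rewrite mxE !eqxx mulr1 !addr0.
  by rewrite big1// => q _; rewrite mxE (negbTE ki) mulr0.
by rewrite mxE eqxx (negbTE kj) mulr0.
Qed.

Lemma mxdotNl A B : mxdot (- A) B = - mxdot A B.
Proof. by rewrite -scaleN1r mxdotZl mulN1r. Qed.

Lemma mxdotNr A B : mxdot A (- B) = - mxdot A B.
Proof. by rewrite mxdotC mxdotNl mxdotC. Qed.

Lemma mxdot_young e A B : 0 < e ->
  2 * mxdot A B <= e^-1 * mxdot A A + e * mxdot B B.
Proof.
move=> e0; rewrite -subr_ge0.
rewrite (_ : _ - _ = e^-1 * mxdot (A - e *: B) (A - e *: B)).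
  by rewrite mulr_ge0 ?mxdot_ge0// invr_ge0 ltW.
rewrite !(mxdotDl, mxdotDr, mxdotNl, mxdotNr, mxdotZl, mxdotZr) (mxdotC B A).
by field; rewrite gt_eqF.
Qed.

Lemma mxdot_sqrD_le A B :
  mxdot (A + B) (A + B) <= 2 * (mxdot A A + mxdot B B).
Proof.
have := mxdot_young A B ltr01.
by rewrite !(mxdotDl, mxdotDr) (mxdotC B A) invr1 !mul1r; lra.
Qed.

End mxdot_theory.

Lemma mxdot_trl (R : realType) n (A B : 'M[R]_n) : mxdot A^T B = mxdot A B^T.
Proof.
rewrite /mxdot exchange_big; apply: eq_bigr => i _.
by apply: eq_bigr => j _; rewrite !mxE.
Qed.

(** * Inverses of elasticity tensors by Cramer's rule *)

Section tensor_inverse.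
Context (R : realType) (d : nat).
Implicit Types (C A : tensor4 R d) (s t : 'M[R]_d).

Lemma tensor_appD C s t :
  tensor_app C (s + t) = tensor_app C s + tensor_app C t.
Proof.
apply/matrixP => i j; rewrite !mxE -big_split; apply: eq_bigr => k _.
by rewrite -big_split; apply: eq_bigr => q _; rewrite !mxE mulrDr.
Qed.

Lemma tensor_appZ C a s : tensor_app C (a *: s) = a *: tensor_app C s.
Proof.
apply/matrixP => i j; rewrite !mxE mulr_sumr; apply: eq_bigr => k _.
by rewrite mulr_sumr; apply: eq_bigr => q _; rewrite !mxE mulrCA.
Qed.

Lemma tensor_app_tr C s : tensor_sym C -> (tensor_app C s)^T = tensor_app C s.
Proof.
move=> symC; apply/matrixP => i j; rewrite !mxE.
by apply: eq_bigr => k _; apply: eq_bigr => q _; rewrite (symC j i k q).1.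
Qed.

Lemma tensor_app_trr C s : tensor_sym C -> tensor_app C s^T = tensor_app C s.
Proof.
move=> symC; apply/matrixP => i j; rewrite !mxE exchange_big.
apply: eq_bigr => k _; apply: eq_bigr => q _; rewrite mxE.
by rewrite (symC i j q k).2 (symC q k i j).1 (symC k q i j).2.
Qed.

Lemma mxdot_tensorC C s t : tensor_sym C ->
  mxdot (tensor_app C s) t = mxdot s (tensor_app C t).
Proof.
move=> symC.
have E u v : mxdot (tensor_app C u) v =
    \sum_p \sum_r C p.1 p.2 r.1 r.2 * u r.1 r.2 * v p.1 p.2.
  rewrite /mxdot pair_bigA; apply: eq_bigr => -[i j] _ /=.
  rewrite mxE mulr_suml -(pair_bigA _ (fun k q => C i j k q * u k q * v i j)).
  by apply: eq_bigr => k _; rewrite mulr_suml.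
rewrite [RHS]mxdotC !E exchange_big; apply: eq_bigr => -[i j] _.
by apply: eq_bigr => -[k q] _; rewrite /= (symC k q i j).2 mulrAC.
Qed.

Definition symmx s : 'M[R]_d := 2^-1 *: (s + s^T).

Lemma symmx_tr s : (symmx s)^T = symmx s.
Proof. by rewrite /symmx linearZ linearD/= trmxK addrC. Qed.

Lemma symmx_id s : s^T = s -> symmx s = s.
Proof.
by move=> ss; rewrite /symmx ss -mulr2n -[s *+ 2]scaler_nat scalerA mulVf ?scale1r//.
Qed.

Lemma tensor_app_symmx C s : tensor_sym C -> tensor_app C (symmx s) = tensor_app C s.
Proof.
move=> symC; rewrite /symmx tensor_appZ tensor_appD tensor_app_trr//.
by rewrite -mulr2n -[X in _ *: X]scaler_nat scalerA mulVf ?scale1r// pnatr_eq0.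
Qed.

Lemma tensor_app_delta C k l i j : tensor_app C (delta_mx k l) i j = C i j k l.
Proof.
rewrite mxE -[RHS](mxE matrix_key (C i j)) -mxdot_delta.
by apply: eq_bigr => a _; apply: eq_bigr => b _; rewrite !mxE.
Qed.

(** A symmetric tensor annihilates skew matrices, so for d > 1 it is not
    invertible as an operator on all matrices. Adding twice the skew part repairs this: the
    sum is invertible exactly when the tensor is invertible on symmetric
    matrices, and it agrees with the tensor there. *)
Definition extended_app C s : 'M[R]_d := tensor_app C s + (s - s^T).

Lemma sym_skew_eq0 s : s^T = s -> s^T = - s -> s = 0.
Proof.
move=> -> /eqP; rewrite -subr_eq0 opprK -mulr2n -scaler_nat scaler_eq0.
by rewrite pnatr_eq0/= => /eqP.
Qed.

Fact extended_app_is_linear C : linear (extended_app C).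
Proof.
move=> a s t; rewrite /extended_app tensor_appD tensor_appZ.
move: (tensor_app C s) (tensor_app C t) => u v.
by apply/matrixP => i j; rewrite !mxE; ring.
Qed.

HB.instance Definition _ C := GRing.isLinear.Build R 'M[R]_d 'M[R]_d _ (extended_app C)
  (extended_app_is_linear C).

Definition extended_mx C : 'M[R]_(d * d) := lin_mx (extended_app C).

(** The inverse of [extended_app C]. Where the determinant vanishes the total
    inverse 0^-1 = 0 makes it the zero map, which is also the default value
    of [tensor_inv]. *)
Definition cramer_app C s : 'M[R]_d :=
  vec_mx (mxvec s *m ((\det (extended_mx C))^-1 *: \adj (extended_mx C))).

Definition cramer_inv C : tensor4 R d :=
  fun i j k l => cramer_app C (symmx (delta_mx k l)) i j.

Definition sym_inverse C A := tensor_sym A /\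
  forall t : 'M[R]_d, t^T = t ->
    tensor_app A (tensor_app C t) = t /\ tensor_app C (tensor_app A t) = t.

(** By the minor symmetries the entries with last indices k, l are those of the
    image of the symmetrised unit matrix. *)
Lemma tensor_sym_ext A B : tensor_sym A -> tensor_sym B ->
  (forall t : 'M[R]_d, t^T = t -> tensor_app A t = tensor_app B t) -> A = B.
Proof.
move=> sA sB AB; apply/funext => i; apply/funext => j.
apply/funext => k; apply/funext => q.
rewrite -(tensor_app_delta A) -(tensor_app_delta B).
by rewrite -(tensor_app_symmx _ sA) -(tensor_app_symmx _ sB) AB// symmx_tr.
Qed.

Lemma sym_inverse_uniq C A B : sym_inverse C A -> sym_inverse C B -> A = B.
Proof.
move=> [sA iA] [sB iB]; apply: tensor_sym_ext => // t tt.
by rewrite -{1}(iB t tt).2 (iA _ _).1// tensor_app_tr.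
Qed.

(** If C s + (s - s^T) = 0, the symmetric summand C s and the skew one both
    vanish; so s is symmetric, and then zero by invertibility. *)
Lemma sym_inverse_det C A : tensor_sym C -> sym_inverse C A ->
  \det (extended_mx C) != 0.
Proof.
move=> sC [sA iA]; apply/det0P => -[v v0].
rewrite -[v]vec_mxK mul_vec_lin => /(congr1 vec_mx).
rewrite mxvecK linear0 /=; set t := vec_mx v => Lt.
have Ct : tensor_app C t = t^T - t.
  by apply/eqP; rewrite -subr_eq0 opprB; apply/eqP.
have ts : t^T = t.
  apply/eqP; rewrite -subr_eq0; apply/eqP/sym_skew_eq0.
    by rewrite -Ct tensor_app_tr.
  by rewrite linearB/= trmxK opprB.
have t0 : t = 0.
  by rewrite -(iA t ts).1 Ct ts subrr -[X in tensor_app _ X](scale0r 0) tensor_appZ scale0r.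
by move: v0; rewrite -[v]vec_mxK -/t t0 linear0 eqxx.
Qed.

(** For symmetric t the solution s of C s + (s - s^T) = t is itself symmetric,
    because s - s^T = t - C s is both skew and symmetric. Hence the inverse of
    the extended operator restricts to an inverse of C on symmetric matrices,
    and it inherits the major symmetry from C by duality. *)
Lemma sym_inverse_cramer C : tensor_sym C -> \det (extended_mx C) != 0 ->
  sym_inverse C (cramer_inv C).
Proof.
move=> sC D0.
have unitM : extended_mx C \in unitmx by rewrite unitmxE unitfE.
have appE s : cramer_app C s = vec_mx (mxvec s *m invmx (extended_mx C)).
  by rewrite /cramer_app /invmx unitM.
have LK s : extended_app C (cramer_app C s) = s.
  by rewrite appE -(mx_rV_lin (extended_app C)) -mulmxA mulVmx// mulmx1 mxvecK.
have KL s : cramer_app C (extended_app C s) = s.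
  by rewrite appE -(mul_vec_lin (extended_app C)) -mulmxA mulmxV// mulmx1 mxvecK.
have capp_tr t : t^T = t -> (cramer_app C t)^T = cramer_app C t.
  move=> ts; set s := cramer_app C t.
  have e : s - s^T = t - tensor_app C s
    by rewrite -[t]LK /extended_app -/s addrAC subrr add0r.
  apply/esym/eqP; rewrite -subr_eq0; apply/eqP/sym_skew_eq0.
    by rewrite e linearB/= ts tensor_app_tr.
  by rewrite linearB/= trmxK opprB.
have Ccapp t : t^T = t -> tensor_app C (cramer_app C t) = t.
  by move=> ts; rewrite -[RHS]LK /extended_app capp_tr// subrr addr0.
have cappD s t : cramer_app C (s + t) = cramer_app C s + cramer_app C t.
  by rewrite !appE linearD/= mulmxDl linearD.
have cappZ a s : cramer_app C (a *: s) = a *: cramer_app C s.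
  by rewrite !appE linearZ/= -scalemxAl linearZ.
have invE t : tensor_app (cramer_inv C) t = cramer_app C (symmx t).
  have symmxD s u : symmx (s + u) = symmx s + symmx u.
    by apply/matrixP => a b; rewrite !mxE; ring.
  have symmxZ a s : symmx (a *: s) = a *: symmx s.
    by apply/matrixP => b c; rewrite !mxE; ring.
  rewrite [in RHS](matrix_sum_delta t); apply/matrixP => i j; rewrite mxE.
  pose F s := cramer_app C (symmx s) i j.
  have F0 : F 0 = 0 by rewrite /F -[X in symmx X](scale0r 0) symmxZ cappZ scale0r mxE.
  have FD s u : F (s + u) = F s + F u by rewrite /F symmxD cappD mxE.
  rewrite -/(F _) (big_morph F FD F0); apply: eq_bigr => k _.
  rewrite (big_morph F FD F0); apply: eq_bigr => q _.
  by rewrite /F symmxZ cappZ mxE mulrC.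
have invs t : t^T = t -> tensor_app (cramer_inv C) t = cramer_app C t.
  by move=> ts; rewrite invE symmx_id.
split; last first.
  move=> t ts; split; last by rewrite invs// Ccapp.
  rewrite invs ?tensor_app_tr// -[RHS]KL; congr (cramer_app C _).
  by rewrite /extended_app ts subrr addr0.
move=> i j k q; split.
  by rewrite /cramer_inv -[in LHS]capp_tr ?symmx_tr// mxE.
have H s t : s^T = s -> t^T = t ->
    mxdot (cramer_app C s) t = mxdot s (cramer_app C t).
  by move=> ss ts; rewrite -{1}(Ccapp t ts) -mxdot_tensorC// Ccapp.
have sD s u : s^T = s -> mxdot s (symmx u) = mxdot s u.
  by move=> ss; rewrite mxdotZr mxdotDr -mxdot_trl ss; field.
rewrite /cramer_inv -mxdot_delta -sD ?capp_tr ?symmx_tr//.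
by rewrite H ?symmx_tr// mxdotC sD ?capp_tr ?symmx_tr// mxdot_delta.
Qed.

(** The explicit formula also covers tensors that are not invertible, so the
    measurability of C^{-1} needs no exceptional null set. *)
Lemma tensor_inv_cramer C : tensor_sym C -> tensor_inv C = cramer_inv C.
Proof.
move=> sC; rewrite /tensor_inv.
have [D0|D0] := eqVneq (\det (extended_mx C)) 0; last first.
  apply: xget_unique; first exact: sym_inverse_cramer.
  by move=> A hA; apply: (sym_inverse_uniq hA); exact: sym_inverse_cramer.
rewrite xgetPN => [|A hA]; last first.
  by have := sym_inverse_det sC hA; rewrite D0 eqxx.
apply/funext => i; apply/funext => j; apply/funext => k; apply/funext => q.
by rewrite /cramer_inv /cramer_app D0 invr0 scale0r mulmx0 linear0 mxE.
Qed.

Lemma tensor_inv_sym C : tensor_sym (tensor_inv C).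
Proof.
rewrite /tensor_inv; case: xgetP => [A _ [sA _]//|_] i j k q; by split.
Qed.

End tensor_inverse.

(** * Measurability of matrix-valued maps *)

Section matrix_measurability.
Context d (X : measurableType d) (R : realType) (D : set X).

Definition mx_measurable m n (B : X -> 'M[R]_(m, n)) :=
  forall i j, measurable_fun D (fun x => B x i j).

Lemma measurable_funV (f : X -> R) :
  measurable_fun D f -> measurable_fun D (fun x => (f x)^-1).
Proof.
(* Squaring makes the base nonnegative, as real powers require; at a zero of f
   both sides vanish. *)
move=> mf; rewrite (_ : (fun _ => _) = f \* (fun x => (f x ^+ 2) `^ (-1))).
  apply: measurable_funM => //.
  apply: (measurableT_comp (measurable_powR _)).
  exact: measurable_funX.
apply/funext => x /=; rewrite powR_inv1 ?sqr_ge0//.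
have [->|f0] := eqVneq (f x) 0; first by rewrite invr0 mul0r.
by field.
Qed.

Lemma measurable_det n (B : X -> 'M[R]_n) :
  mx_measurable B -> measurable_fun D (fun x => \det (B x)).
Proof.
move=> mB; apply: measurable_sum => s; apply: measurable_funM => //.
by apply: measurable_prod => i _; exact: mB.
Qed.

Lemma measurable_adj n (B : X -> 'M[R]_n) :
  mx_measurable B -> mx_measurable (fun x => \adj (B x)).
Proof.
move=> mB i j; rewrite (_ : (fun _ => _) = fun x => cofactor (B x) j i); last first.
  by apply/funext => x; rewrite mxE.
apply: measurable_funM => //; apply: measurable_det => a b.
rewrite (_ : (fun _ => _) = fun x => B x (lift j a) (lift i b)); first exact: mB.
by apply/funext => x; rewrite !mxE.
Qed.

Lemma measurable_tensor_app n (C : X -> tensor4 R n) (s : X -> 'M[R]_n) :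
  (forall i j k l, measurable_fun D (fun x => C x i j k l)) ->
  mx_measurable s -> mx_measurable (fun x => tensor_app (C x) (s x)).
Proof.
move=> mC ms i j.
rewrite (_ : (fun _ => _) =
    fun x => \sum_k \sum_l C x i j k l * s x k l); last first.
  by apply/funext => x; rewrite mxE.
apply: measurable_sum => k; apply: measurable_sum => l.
by apply: measurable_funM.
Qed.

Lemma measurable_mxdot m n (s t : X -> 'M[R]_(m, n)) :
  mx_measurable s -> mx_measurable t ->
  measurable_fun D (fun x => mxdot (s x) (t x)).
Proof.
move=> ms mt; apply: measurable_sum => i; apply: measurable_sum => j.
exact: measurable_funM.
Qed.

Lemma measurable_tensor_inv n (C : X -> tensor4 R n) :
  (forall i j k l, measurable_fun D (fun x => C x i j k l)) ->
  (forall x, D x -> tensor_sym (C x)) ->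
  forall i j k l, measurable_fun D (fun x => tensor_inv (C x) i j k l).
Proof.
move=> mC symC i j k l.
apply: (eq_measurable_fun (fun x => cramer_inv (C x) i j k l)).
  by move=> x xD; rewrite tensor_inv_cramer//; exact/symC/set_mem.
have mK : mx_measurable (fun x => extended_mx (C x)).
  move=> a b; case/mxvec_indexP: b => b c.
  rewrite (_ : (fun _ => _) =
      fun x => extended_app (C x) (vec_mx (delta_mx 0 a)) b c); last first.
    by apply/funext => x; rewrite mxE /= mxvecE.
  rewrite (_ : (fun _ => _) = fun x => tensor_app (C x) (vec_mx (delta_mx 0 a)) b c
     + ((vec_mx (delta_mx 0 a)) b c - (vec_mx (delta_mx 0 a)) c b)); last first.
    by apply/funext => x; rewrite /extended_app [LHS]mxE; congr (_ + _); rewrite !mxE.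
  by apply: measurable_funD => //; apply: measurable_tensor_app.
rewrite (_ : (fun _ => _) = fun x => \sum_a mxvec (symmx (delta_mx k l)) 0 a *
   ((\det (extended_mx (C x)))^-1 * \adj (extended_mx (C x)) a (mxvec_index i j))); last first.
  apply/funext => x; rewrite /cramer_inv /cramer_app mxE [LHS]mxE.
  by apply: eq_bigr => a _; rewrite [in LHS]mxE.
apply: measurable_sum => a; apply: measurable_funM => //.
apply: measurable_funM; last exact: measurable_adj.
by apply: measurable_funV; exact: measurable_det.
Qed.

End matrix_measurability.

(** * Real integrals under almost everywhere bounds *)

Section ae_Rintegral.
Context d (X : measurableType d) (R : realType).
Context (mu : {measure set X -> \bar R}) (D : set X).
Hypothesis mD : measurable D.
Implicit Types f g : X -> R.

Lemma integrable_funD f g : mu.-integrable D (EFin \o f) ->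
  mu.-integrable D (EFin \o g) -> mu.-integrable D (EFin \o (fun x => f x + g x)).
Proof. by move=> intf intg; exact: (integrableD mD intf intg). Qed.

Lemma integrable_funZ c f : mu.-integrable D (EFin \o f) ->
  mu.-integrable D (EFin \o (fun x => c * f x)).
Proof. by move=> intf; exact: (integrableZl mD c intf). Qed.

Lemma ae_le_integrable f g : measurable_fun D f -> mu.-integrable D (EFin \o g) ->
  (\forall x \ae mu, D x -> `|f x| <= g x) -> mu.-integrable D (EFin \o f).
Proof.
move=> mf ig fg; apply/integrableP; split; first exact/measurable_EFinP.
have [mg gfin] := integrableP _ _ _ ig.
apply: le_lt_trans gfin; apply: ae_ge0_le_integral => //.
- by do 2 apply: measurableT_comp => //.
- by apply: measurableT_comp.
by apply: filterS fg => x fg /fg; rewrite /= lee_fin => /le_trans; apply; exact: ler_norm.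
Qed.

Lemma ae_le_Rintegral f g : mu.-integrable D (EFin \o f) ->
  mu.-integrable D (EFin \o g) -> (\forall x \ae mu, D x -> f x <= g x) ->
  \int[mu]_(x in D) f x <= \int[mu]_(x in D) g x.
Proof.
move=> intf intg [N [mN N0 fgN]]; rewrite /Rintegral.
rewrite (negligible_integral mN mD intf N0) (negligible_integral mN mD intg N0).
apply: le_Rintegral; first exact: measurableD.
- by apply: (integrableS mD _ _ intf) => //; exact: measurableD.
- by apply: (integrableS mD _ _ intg) => //; exact: measurableD.
move=> x [Dx Nx]; apply: contrapT => fgx; apply: Nx; apply: fgN => /= H.
exact/fgx/H.
Qed.

Lemma ae_Rintegral_ge0 f : mu.-integrable D (EFin \o f) ->
  (\forall x \ae mu, D x -> 0 <= f x) -> 0 <= \int[mu]_(x in D) f x.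
Proof.
move=> intf f0; apply: (@le_trans _ _ (\int[mu]_(x in D) (cst 0 x))).
  by rewrite Rintegral_cst// mul0r.
by apply: ae_le_Rintegral => //; exact: integrable0.
Qed.

End ae_Rintegral.

(** * Square integrable matrix fields *)

Section L2_theory.
Context (R : realType) (d : nat) (Om : set 'rV[R]_d).
Hypothesis mOm : measurable Om.
Local Notation mu := (lebesgue_rV R d).
Context (m n : nat).
Implicit Types u v w : 'rV[R]_d -> 'M[R]_(m, n).

Lemma L2_mx_measurable u : L2 Om u -> mx_measurable Om u.
Proof. by move=> Lu i j; exact: (Lu i j).1. Qed.

Lemma L2_integrable_sqr u : L2 Om u -> mu.-integrable Om (EFin \o (fun x => mxdot (u x) (u x))).
Proof.
move=> Lu; rewrite (_ : _ \o _ =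
   fun x => (\sum_i \sum_j ((u x i j) ^+ 2)%:E)%E); last first.
  apply/funext => x /=; rewrite -sumEFin; apply: eq_bigr => i _.
  by rewrite -sumEFin; apply: eq_bigr => j _; rewrite expr2.
apply: integrable_sum => // i _; apply: integrable_sum => // j _.
exact: (Lu i j).2.
Qed.

Lemma normr_mxdot_le (s t : 'M[R]_(m, n)) :
  `|mxdot s t| <= mxdot s s + mxdot t t.
Proof.
have H1 := mxdot_ge0 (s + t); have H2 := mxdot_ge0 (s - t).
have H3 := mxdot_ge0 s; have H4 := mxdot_ge0 t.
rewrite !(mxdotDl, mxdotDr, mxdotNl, mxdotNr) (mxdotC t s) in H1 H2.
by rewrite ler_norml; apply/andP; split; lra.
Qed.

Lemma L2_integrable_mxdot u v : L2 Om u -> L2 Om v ->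
  mu.-integrable Om (EFin \o (fun x => mxdot (u x) (v x))).
Proof.
move=> Lu Lv; apply: (ae_le_integrable mOm (g := fun x => mxdot (u x) (u x) + mxdot (v x) (v x))).
- by apply: measurable_mxdot; exact: L2_mx_measurable.
- by apply: integrable_funD => //; exact: L2_integrable_sqr.
- by apply: nearW => x _; exact: normr_mxdot_le.
Qed.

Lemma L2_axpy a u v : L2 Om u -> L2 Om v -> L2 Om (a *: u + v).
Proof.
move=> Lu Lv i j; have [mu_ iu] := Lu i j; have [mv iv] := Lv i j.
have E x : (a *: u + v) x i j = a * u x i j + v x i j by rewrite !mxE.
have mw : measurable_fun Om (fun x => (a *: u + v) x i j).
  under eq_fun do rewrite E.
  by apply: measurable_funD => //; exact: measurable_funM.
split=> //.
apply: (ae_le_integrable mOm (f := fun x => (a *: u + v) x i j ^+ 2)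
    (g := fun x => (2 * a ^+ 2) * u x i j ^+ 2 + 2 * v x i j ^+ 2)).
- exact: measurable_funX.
- by apply: integrable_funD => //; exact: integrable_funZ.
- apply: nearW => x _; rewrite ger0_norm ?sqr_ge0// E.
  by have := sqr_ge0 (a * u x i j - v x i j); nra.
Qed.

Lemma L2_sub u v : L2 Om u -> L2 Om v -> L2 Om (u - v).
Proof. by move=> Lu Lv; rewrite addrC -scaleN1r; exact: L2_axpy. Qed.

Lemma L2dot_ge0 u : 0 <= L2dot Om u u.
Proof. by apply: Rintegral_ge0 => x _; exact: mxdot_ge0. Qed.

Lemma L2dot_axpy a u v : L2 Om u -> L2 Om v ->
  L2dot Om (a *: u + v) (a *: u + v) =
  a ^+ 2 * L2dot Om u u + 2 * a * L2dot Om u v + L2dot Om v v.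
Proof.
move=> Lu Lv; have iuu := L2_integrable_mxdot Lu Lu.
have iuv := L2_integrable_mxdot Lu Lv; have ivv := L2_integrable_mxdot Lv Lv.
have i1 := integrable_funZ mOm (a ^+ 2) iuu.
have i2 := integrable_funZ mOm (2 * a) iuv.
have i3 := integrable_funD mOm i1 i2.
rewrite /L2dot -!RintegralZl// -!RintegralD//.
apply: eq_Rintegral => x _.
by rewrite !(mxdotDl, mxdotDr, mxdotZl, mxdotZr) (mxdotC (v x)); ring.
Qed.

(** The quadratic a |-> ||a u + v||^2 is nonnegative; evaluate it at its
    minimiser if ||u|| is nonzero, and otherwise at a point where a nonconstant
    affine function is -1. *)
Lemma L2_cauchy_schwarz u v : L2 Om u -> L2 Om v ->
  L2dot Om u v <= L2norm Om u * L2norm Om v.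
Proof.
move=> Lu Lv; rewrite -sqrtrM ?L2dot_ge0//.
have H a : 0 <= a ^+ 2 * L2dot Om u u + 2 * a * L2dot Om u v + L2dot Om v v.
  by rewrite -L2dot_axpy// L2dot_ge0.
have := L2dot_ge0 u; have := L2dot_ge0 v.
move: (L2dot Om u u) (L2dot Om u v) (L2dot Om v v) H => p q r H r0 p0.
apply: (le_trans (ler_norm q)); rewrite -sqrtr_sqr ler_wsqrtr//.
have [pE|pn0] := eqVneq p 0; last first.
  have pp : 0 < p by rewrite lt_neqAle eq_sym pn0.
  have := H (- q / p); rewrite (_ : _ + r = (p * r - q ^+ 2) / p); last by field.
  by rewrite pmulr_lge0 ?invr_gt0// subr_ge0.
rewrite pE mul0r; have [->|q0] := eqVneq q 0; first by rewrite expr0n.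
have := H (- (r + 1) / (2 * q)); rewrite pE.
rewrite (_ : _ + r = -1); first by rewrite oppr_ge0 ler10.
by field.
Qed.

Lemma L2norm_ge0 u : 0 <= L2norm Om u.
Proof. exact: sqrtr_ge0. Qed.

Lemma L2norm_sqr u : L2norm Om u ^+ 2 = L2dot Om u u.
Proof. by rewrite sqr_sqrtr// L2dot_ge0. Qed.

Lemma L2norm_triangle u v : L2 Om u -> L2 Om v ->
  L2norm Om (u + v) <= L2norm Om u + L2norm Om v.
Proof.
move=> Lu Lv; rewrite -(@ler_pXn2r _ 2)// ?nnegrE ?addr_ge0 ?L2norm_ge0//.
have := L2_cauchy_schwarz Lu Lv.
by rewrite L2norm_sqr -[u]scale1r L2dot_axpy// scale1r sqrrD !L2norm_sqr; lra.
Qed.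

Lemma L2norm_subC u v : L2norm Om (u - v) = L2norm Om (v - u).
Proof.
congr Num.sqrt; apply: eq_Rintegral => x _.
have -> : (u - v) x = - ((v - u) x) by rewrite -opprB.
by rewrite mxdotNl mxdotNr opprK.
Qed.

Lemma L2norm_dist u v : L2 Om u -> L2 Om v ->
  `|L2norm Om u - L2norm Om v| <= L2norm Om (u - v).
Proof.
move=> Lu Lv; rewrite ler_norml lerBlDl andbC lerNl opprB lerBlDl.
have := L2norm_triangle Lu (L2_sub Lv Lu).
have := L2norm_triangle Lv (L2_sub Lu Lv).
by rewrite !(addrC _ (_ - _)) !subrK (L2norm_subC v u) => -> ->.
Qed.
End L2_theory.

(** * Continuous functions and the essential supremum *)

Section continuous_ess_sup.
Context (R : realType) (a b : R).
Local Notation lam := (mrestr (@lebesgue_measure R) (measurable_itv `[a, b])).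

(** If N t were above an almost everywhere bound, so would be all values of N
    near t, hence on an interval of positive length. The maximum of N is needed
    as well: it shows that the essential supremum is not +oo, which [fine]
    would send to 0. *)
Lemma within_continuous_le_ess_sup (N : R -> R) (t : R) : a < b ->
  {within `[a, b], continuous N} -> a <= t <= b ->
  N t <= fine (ess_sup lam (fun s => (N s)%:E)).
Proof.
move=> ab cN tab.
have [c _ maxc] := EVT_max (ltW ab) cN.
have Sc : (ess_sup lam (fun s => (N s)%:E) <= (N c)%:E)%E.
  apply/ess_supP; exists (~` `[a, b]); split.
  - by apply: measurableC; exact: measurable_itv.
  - transitivity (@lebesgue_measure R (~` `[a, b] `&` `[a, b])) => //.
    by rewrite setICl measure0.
  - by move=> s; apply: contra_not => sab /=; rewrite lee_fin; exact: maxc.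
have Sr r : (ess_sup lam (fun s => (N s)%:E) <= r%:E)%E -> N t <= r.
  move=> /ess_supP[Z [mZ Z0 NZ]]; rewrite leNgt; apply/negP => rNt.
  have := (subspace_continuousP _ _).1 cN t.
  rewrite /= in_itv/= => /(_ tab)/cvgr_gt/(_ _ rNt).
  rewrite near_withinE => /nbhs_ballP[e /= e0 er].
  (* t may be an endpoint of [a, b], so the interval around it is truncated. *)
  pose p := Num.max a (t - e / 2); pose q := Num.min b (t + e / 2).
  have pq : p < q.
    have [ta tb] := andP tab.
    by rewrite /p /q gt_max !lt_min ab/= ?(le_lt_trans tb) //; apply/and3P; split; lra.
  have sub : `[p, q] `<=` Z `&` `[a, b].
    move=> s; rewrite /= in_itv/= ge_max le_min.
    move=> /andP[/andP[as_ es] /andP[sb se]].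
    have sab : `[a, b]%classic s by rewrite /= in_itv/= as_ sb.
    split=> //; apply: NZ => /=; apply/negP; rewrite lee_fin -ltNge.
    apply: er => //; rewrite /ball/= ltr_norml; apply/andP; split; lra.
  have : (lebesgue_measure `[p, q] <= lebesgue_measure (Z `&` `[a, b]))%E.
    by apply: le_measure => //; rewrite inE; [exact: measurable_itv|
      apply: measurableI => //; exact: measurable_itv].
  have -> : lebesgue_measure (Z `&` `[a, b]) = 0%E by exact: Z0.
  by rewrite lebesgue_measure_itv/= lte_fin pq -EFinB lee_fin leNgt subr_gt0 pq.
move: Sc Sr; case: (ess_sup _ _) => [r _ /(_ r)->//|//|_ /(_ (N t - 1))].
by rewrite leNye => /(_ isT); rewrite lerBrDr gerDl ler10.
Qed.

End continuous_ess_sup.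

(** The reverse triangle inequality turns the continuity of f with values in
    L^2 into the continuity of its norm. *)
Lemma L2norm_le_Linf (R : realType) (d : nat) (Om : set 'rV[R]_d) m n (T : R)
    (f : R -> 'rV[R]_d -> 'M[R]_(m, n)) : measurable Om -> 0 < T ->
  C0_L2 Om T f -> forall t, 0 <= t <= T ->
  L2norm Om (f t) <= Linf_L2_norm Om T f.
Proof.
move=> mOm T0 [Lf cf] t tT.
apply: (@within_continuous_le_ess_sup _ _ _ (fun s => L2norm Om (f s))) => //.
apply/subspace_continuousP => s; rewrite /= in_itv/= => sT.
apply/cvgrPdist_le => e e0.
have /cvgrPdist_le/(_ e e0) := cf s sT.
rewrite !near_withinE; apply: filterS => x dx xT.
have {dx} := dx xT; rewrite sub0r normrN ger0_norm ?L2norm_ge0//; apply: le_trans.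
move: sT xT; rewrite /= !in_itv/= => sT xT.
by rewrite -L2norm_subC L2norm_dist//; exact: Lf.
Qed.

(** * The discrete Gronwall inequality and midpoints *)

Lemma convex_polyhedral_measurable (R : realType) (d : nat) (Om : set 'rV[R]_d) :
  convex_polyhedral_domain Om -> measurable Om.
Proof.
move=> [_ _ [k [nu [c ->]]]].
rewrite (_ : [set _ | _] = \bigcap_(i in [set: 'I_k]) [set x | mxdot (nu i) x < c i]).
  apply: fin_bigcap_measurable; first exact: finite_finset.
  move=> i _; rewrite -[X in measurable X]setTI.
  rewrite (_ : [set x | _] = (fun x => mxdot (nu i) x) @^-1` `]-oo, c i[); last first.
    by apply/seteqP; split => x; rewrite /= in_itv.
  apply: (@measurable_mxdot _ _ _ _ _ _ (cst (nu i)) id) => //.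
  by move=> a b; rewrite (ord1 a); exact: measurable_coord.
by apply/seteqP; split => x /= H i; [move=> _; exact: H|exact: (H i)].
Qed.

(** Solving for the new value gives
    (1 - dt / 2) (E_{n+1} + G) <= (1 + dt / 2) (E_n + G), and
    1 + dt / 2 <= (1 + 2 dt) (1 - dt / 2) amounts to dt <= 1. The steps
    compound to (1 + 2 dt)^J <= exp(2 T). *)
Lemma crank_nicolson_gronwall (R : realType) (T dt G : R) (M : nat) (E : nat -> R) :
  0 < dt -> dt < 1 -> M%:R * dt <= T -> 0 <= G -> (forall n, (n <= M)%N -> 0 <= E n) ->
  (forall n, (n < M)%N -> E n.+1 - E n <= dt * ((E n + E n.+1) / 2 + G)) ->
  forall J, (J <= M)%N -> E J + G <= expR (2 * T) * (E 0%N + G).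
Proof.
move=> dt0 dt1 MT G0 E0 step J JM.
have EG n : (n <= M)%N -> 0 <= E n + G by move=> nM; rewrite addr_ge0// E0.
have pow : E J + G <= (1 + 2 * dt) ^+ J * (E 0%N + G).
  elim: J JM => [|n IH] nM; first by rewrite mul1r.
  have {}IH := IH (ltnW nM).
  have dt2 : 0 < 1 + 2 * dt by clear -dt0; lra.
  apply: (@le_trans _ _ ((1 + 2 * dt) * (E n + G))); last first.
    by rewrite exprS -mulrA ler_pM2l.
  have := step _ nM; have := EG _ (ltnW nM); clear -dt0 dt1.
  move: (E n) (E n.+1) => x y xG h.
  have dt_half : 0 < 1 - dt / 2 by clear -dt1; lra.
  rewrite -(ler_pM2l dt_half).
  apply: (@le_trans _ _ ((1 + dt / 2) * (x + G))); first by clear -h; lra.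
  by rewrite mulrA ler_wpM2r//; clear -dt0 dt1; nra.
apply: (le_trans pow); rewrite ler_wpM2r ?EG//.
apply: (@le_trans _ _ (expR (2 * dt) ^+ J)).
  have dt2 : 0 <= 1 + 2 * dt by clear -dt0; lra.
  by apply: lerXn2r; rewrite ?nnegrE ?expR_ge0 ?expR_ge1Dx.
rewrite -expRM_natl ler_expR mulrCA ler_pM2l//; apply: le_trans MT.
by rewrite ler_pM2r// ler_nat.
Qed.

Section midpoints.
Context (R : realType) (d : nat) (Om : set 'rV[R]_d).
Hypothesis mOm : measurable Om.
Context (m n : nat).
Implicit Types (phi : nat -> 'rV[R]_d -> 'M[R]_(m, n)).

Lemma findim_midpoint V phi k : findim_space Om V ->
  V (phi k) -> V (phi k.+1) -> V (midpoint phi k).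
Proof.
move=> [V0 Vlin _] Vk Vk1; rewrite /midpoint -[_ *: _]addr0; apply: (Vlin) => //.
by rewrite -[phi k]scale1r; exact: Vlin.
Qed.

Lemma L2_midpoint phi k : L2 Om (phi k) -> L2 Om (phi k.+1) -> L2 Om (midpoint phi k).
Proof.
move=> Lk Lk1; rewrite /midpoint.
have Ls : L2 Om (phi k + phi k.+1) by rewrite -[phi k]scale1r; exact: L2_axpy.
rewrite (_ : _ *: _ = (2^-1 - 1) *: (phi k + phi k.+1) + (phi k + phi k.+1)).
  exact: L2_axpy.
by rewrite scalerBl scale1r subrK.
Qed.
End midpoints.

(** * The kinetic energy *)

Section kinetic_energy.
Context (R : realType) (d : nat) (Om : set 'rV[R]_d).
Hypothesis mOm : measurable Om.
Local Notation mu := (lebesgue_rV R d).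
Context (rho : 'rV[R]_d -> R) (rho0 rho1 : R).
Hypothesis rho0_gt0 : 0 < rho0.
Hypothesis mrho : measurable_fun Om rho.
Hypothesis hrho : \forall x \ae mu, Om x -> rho0 <= rho x <= rho1.
Implicit Types (v f : nat -> 'rV[R]_d -> 'rV[R]_d) (w : 'rV[R]_d -> 'rV[R]_d).

Lemma integrable_form_c w : L2 Om w ->
  mu.-integrable Om (EFin \o (fun x => rho x * mxdot (w x) (w x))).
Proof.
move=> Lw; apply: (ae_le_integrable mOm (g := fun x => rho1 * mxdot (w x) (w x))).
- by apply: measurable_funM => //; apply: measurable_mxdot; exact: L2_mx_measurable.
- by apply: integrable_funZ => //; exact: L2_integrable_sqr.
- apply: filterS hrho => x h /h /andP[h0 h1].
  have r0 : 0 <= rho x by apply: le_trans h0; exact: ltW.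
  by rewrite ger0_norm ?mulr_ge0 ?mxdot_ge0// ler_wpM2r// mxdot_ge0.
Qed.

Lemma norm_c_sqr w : L2 Om w -> norm_c Om rho w ^+ 2 = form_c Om rho w w.
Proof.
move=> Lw; rewrite sqr_sqrtr//; apply: ae_Rintegral_ge0 => //.
  exact: integrable_form_c.
apply: filterS hrho => x h /h /andP[h0 _].
by rewrite mulr_ge0 ?mxdot_ge0//; apply: le_trans h0; exact: ltW.
Qed.

(** (v1 - v0) . (v1 + v0) = |v1|^2 - |v0|^2, by symmetry of the form. *)
Lemma form_c_diffquot dt v k : L2 Om (v k) -> L2 Om (v k.+1) ->
  form_c Om rho (diffquot dt v k) (midpoint v k) =
  (2 * dt)^-1 * (form_c Om rho (v k.+1) (v k.+1) - form_c Om rho (v k) (v k)).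
Proof.
move=> Lk Lk1; have i0 := integrable_form_c Lk; have i1 := integrable_form_c Lk1.
rewrite /form_c -RintegralB// -RintegralZl//; last exact: (integrableB mOm i1 i0).
apply: eq_Rintegral => x _.
rewrite (_ : diffquot dt v k x = dt^-1 *: (v k.+1 x - v k x))//.
rewrite (_ : midpoint v k x = 2^-1 *: (v k x + v k.+1 x))//.
rewrite !(mxdotDl, mxdotDr, mxdotZl, mxdotZr, mxdotNl) (mxdotC (v k.+1 x) (v k x)).
by rewrite invfM; ring.
Qed.

(** The weight rho0 in Young's inequality is what lets the velocity term be
    absorbed by the kinetic energy, as rho0 <= rho; convexity of the square
    passes from midpoints to nodes. *)
Lemma L2dot_midpoint_le f v k :
  L2 Om (f k) -> L2 Om (f k.+1) -> L2 Om (v k) -> L2 Om (v k.+1) ->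
  2 * L2dot Om (midpoint f k) (midpoint v k) <=
  rho0^-1 * ((L2norm Om (f k) ^+ 2 + L2norm Om (f k.+1) ^+ 2) / 2) +
  (form_c Om rho (v k) (v k) + form_c Om rho (v k.+1) (v k.+1)) / 2.
Proof.
move=> Lf Lf1 Lv Lv1; rewrite !L2norm_sqr.
have ifv := L2_integrable_mxdot mOm (L2_midpoint mOm Lf Lf1) (L2_midpoint mOm Lv Lv1).
have if0 := L2_integrable_mxdot mOm Lf Lf; have if1 := L2_integrable_mxdot mOm Lf1 Lf1.
have iv0 := integrable_form_c Lv; have iv1 := integrable_form_c Lv1.
have iF := integrable_funZ mOm (rho0^-1 / 2) (integrable_funD mOm if0 if1).
have iV := integrable_funZ mOm 2^-1 (integrable_funD mOm iv0 iv1).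
have -> : rho0^-1 * ((L2dot Om (f k) (f k) + L2dot Om (f k.+1) (f k.+1)) / 2) +
    (form_c Om rho (v k) (v k) + form_c Om rho (v k.+1) (v k.+1)) / 2 =
    \int[mu]_(x in Om) (rho0^-1 / 2 * (mxdot (f k x) (f k x) + mxdot (f k.+1 x) (f k.+1 x))
     + 2^-1 * (rho x * mxdot (v k x) (v k x) + rho x * mxdot (v k.+1 x) (v k.+1 x))).
  rewrite RintegralD// !RintegralZl//; do ?exact: integrable_funD.
  by rewrite !RintegralD// /L2dot /form_c; ring.
rewrite /L2dot -RintegralZl//; apply: ae_le_Rintegral => //.
- exact: integrable_funZ.
- exact: integrable_funD.
apply: filterS hrho => x h /h /andP[h0 _].
rewrite (_ : midpoint f k x = 2^-1 *: (f k x + f k.+1 x))//.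
rewrite (_ : midpoint v k x = 2^-1 *: (v k x + v k.+1 x))//.
rewrite mxdotZl mxdotZr.
have := mxdot_young (f k x + f k.+1 x) (v k x + v k.+1 x) rho0_gt0.
have := ler_wpM2l (ltW (divr_gt0 ltr01 rho0_gt0)) (mxdot_sqrD_le (f k x) (f k.+1 x)).
rewrite div1r.
have := ler_wpM2l (ltW rho0_gt0) (mxdot_sqrD_le (v k x) (v k.+1 x)).
have f0 := mxdot_ge0 (f k x); have f1 := mxdot_ge0 (f k.+1 x).
have v0 := mxdot_ge0 (v k x); have v1 := mxdot_ge0 (v k.+1 x).
have := ler_wpM2r (addr_ge0 v0 v1) h0.
have : 0 <= rho0^-1 * (mxdot (f k x) (f k x) + mxdot (f k.+1 x) (f k.+1 x)).
  by rewrite mulr_ge0 ?addr_ge0// invr_ge0 ltW.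
have : 0 <= rho0 * (mxdot (v k x) (v k x) + mxdot (v k.+1 x) (v k.+1 x)).
  by rewrite mulr_ge0 ?addr_ge0// ltW.
lra.
Qed.

End kinetic_energy.

(** * The elastic energy *)

Section elastic_energy.
Context (R : realType) (d : nat) (Om : set 'rV[R]_d).
Hypothesis mOm : measurable Om.
Local Notation mu := (lebesgue_rV R d).
Context (C : 'rV[R]_d -> tensor4 R d) (M0 M1 : R).
Hypothesis M0_gt0 : 0 < M0.
Hypothesis mC : forall i j k l, measurable_fun Om (fun x => C x i j k l).
Hypothesis symC : forall x, Om x -> tensor_sym (C x).
Hypothesis hC : \forall x \ae mu, Om x -> forall tau : 'M[R]_d, tau^T = tau ->
  M0 * mxdot tau tau <= mxdot (tensor_app (tensor_inv (C x)) tau) tau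
    <= M1 * mxdot tau tau.
Implicit Types (sigma : nat -> 'rV[R]_d -> 'M[R]_d) (s : 'rV[R]_d -> 'M[R]_d).

(** The bounds on C^{-1} concern symmetric matrices only, and the stresses are
    symmetric only almost everywhere. *)
Lemma Hdiv_form_a_bounds s : Hdiv Om s -> \forall x \ae mu, Om x ->
  0 <= mxdot (tensor_app (tensor_inv (C x)) (s x)) (s x) <= M1 * mxdot (s x) (s x).
Proof.
move=> [_ ss _]; have ss' : \forall x \ae mu, forall i j, Om x -> s x i j = s x j i.
  by do 2 apply: filter_forall => ?; exact: ss.
apply: filterS2 ss' hC => x sx h Ox.
have /(h Ox)/andP[h0 ->] : (s x)^T = s x by apply/matrixP => i j; rewrite mxE sx.
by rewrite andbT (le_trans _ h0)// mulr_ge0 ?mxdot_ge0// ltW.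
Qed.

Lemma integrable_form_a s : Hdiv Om s ->
  mu.-integrable Om (EFin \o (fun x => mxdot (tensor_app (tensor_inv (C x)) (s x)) (s x))).
Proof.
move=> Hs; have [Ls _ _] := Hs.
apply: (ae_le_integrable mOm (g := fun x => M1 * mxdot (s x) (s x))).
- apply: measurable_mxdot; last exact: L2_mx_measurable.
  apply: measurable_tensor_app; last exact: L2_mx_measurable.
  exact: measurable_tensor_inv.
- by apply: integrable_funZ => //; exact: L2_integrable_sqr.
- by apply: filterS (Hdiv_form_a_bounds Hs) => x h /h /andP[h0 h1]; rewrite ger0_norm.
Qed.

Lemma form_a_ge0 s : Hdiv Om s -> 0 <= form_a Om C s s.
Proof.
move=> Hs; apply: ae_Rintegral_ge0 => //; first exact: integrable_form_a.
by apply: filterS (Hdiv_form_a_bounds Hs) => x h /h /andP[].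
Qed.

Lemma norm_a_sqr s : Hdiv Om s -> norm_a Om C s ^+ 2 = form_a Om C s s.
Proof. by move=> Hs; rewrite sqr_sqrtr// form_a_ge0. Qed.

Lemma form_a_diffquot dt sigma k : Hdiv Om (sigma k) -> Hdiv Om (sigma k.+1) ->
  form_a Om C (diffquot dt sigma k) (midpoint sigma k) =
  (2 * dt)^-1 * (form_a Om C (sigma k.+1) (sigma k.+1) - form_a Om C (sigma k) (sigma k)).
Proof.
move=> Hk Hk1; have i0 := integrable_form_a Hk; have i1 := integrable_form_a Hk1.
rewrite /form_a -RintegralB// -RintegralZl//; last exact: (integrableB mOm i1 i0).
apply: eq_Rintegral => x _.
rewrite (_ : diffquot dt sigma k x = dt^-1 *: (sigma k.+1 x - sigma k x))//.
rewrite (_ : midpoint sigma k x = 2^-1 *: (sigma k x + sigma k.+1 x))//.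
have sA := tensor_inv_sym (C x).
rewrite -scaleN1r !(tensor_appZ, tensor_appD) !(mxdotDl, mxdotDr, mxdotZl, mxdotZr).
rewrite (mxdot_tensorC (sigma k.+1 x) (sigma k x) sA) (mxdotC (sigma k.+1 x)).
by rewrite invfM; ring.
Qed.

End elastic_energy.
(** * Stability of the scheme *)

Theorem theorem4p1 (R : realType) (d : nat) (hd : d = 2%N \/ d = 3%N)
  (Om : set 'rV[R]_d) (hOm : convex_polyhedral_domain Om)
  (T : R) (hT : 0 < T)
  (rho : 'rV[R]_d -> R) (rho0 rho1 : R) (hrho0 : 0 < rho0)
  (mrho : measurable_fun Om rho)
  (hrho : \forall x \ae lebesgue_rV R d, Om x -> rho0 <= rho x <= rho1)
  (C : 'rV[R]_d -> tensor4 R d) (M0 M1 : R) (hM0 : 0 < M0) (hM1 : 0 < M1)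
  (mC : forall i j k l, measurable_fun Om (fun x => C x i j k l))
  (symC : forall x, Om x -> tensor_sym (C x))
  (hC : \forall x \ae lebesgue_rV R d, Om x ->
     forall tau : 'M[R]_d, tau^T = tau ->
       M0 * mxdot tau tau <= mxdot (tensor_app (tensor_inv (C x)) tau) tau
         <= M1 * mxdot tau tau)
  (I : Type) (Th : I -> set (set 'rV[R]_d))
  (hTh : forall i, mesh Om (Th i)) (srTh : shape_regular Th)
  (Hh : I -> set ('rV[R]_d -> 'M[R]_d)) (Vh : I -> set ('rV[R]_d -> 'rV[R]_d))
  (hHh : forall i, findim_space Om (Hh i) /\ Hh i `<=` Hdiv Om)
  (hVh : forall i, findim_space Om (Vh i) /\ Vh i `<=` L2 Om)
  (his : exists2 K : R, 0 < K & forall i, inf_sup Om (Hh i) (Vh i) K)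
  (IH : I -> ('rV[R]_d -> 'M[R]_d) -> 'rV[R]_d -> 'M[R]_d)
  (IV : I -> ('rV[R]_d -> 'rV[R]_d) -> 'rV[R]_d -> 'rV[R]_d)
  (hIH : forall i, operator_into Om (Hdiv Om) (Hh i) (IH i))
  (hIV : forall i, operator_into Om (L2 Om) (Vh i) (IV i))
  (l : nat)
  (hint : exists2 K : R, 0 < K & forall i,
     (forall psi, Hdiv Om psi -> Hl Om l psi ->
        L2norm Om (psi - IH i psi) <= K * mesh_size (Th i) ^+ l * Hl_norm Om l psi) /\
     (forall phi, L2 Om phi -> Hl Om l phi ->
        L2norm Om (phi - IV i phi) <= K * mesh_size (Th i) ^+ l * Hl_norm Om l phi)) :
  exists2 K : R, 0 < K &
    forall (f : R -> 'rV[R]_d -> 'rV[R]_d)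
      (psi0 : 'rV[R]_d -> 'M[R]_d) (phi1 : 'rV[R]_d -> 'rV[R]_d),
    C0_L2 Om T f -> Hdiv Om psi0 -> L2 Om phi1 ->
    forall (i : I) (M : nat), (0 < M)%N -> T / M%:R < 1 ->
    forall (sigma : nat -> 'rV[R]_d -> 'M[R]_d)
      (v : nat -> 'rV[R]_d -> 'rV[R]_d),
    eq_ae Om (sigma 0%N) (IH i psi0) -> eq_ae Om (v 0%N) (IV i phi1) ->
    crank_nicolson Om rho C (T / M%:R) M (fun n => f (n%:R * (T / M%:R)))
      (Hh i) (Vh i) sigma v ->
    forall J : nat, (1 <= J <= M)%N ->
      norm_c Om rho (v J) ^+ 2 + norm_a Om C (sigma J) ^+ 2 <=
      K * (norm_a Om C (sigma 0%N) ^+ 2 + norm_c Om rho (v 0%N) ^+ 2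
           + Linf_L2_norm Om T f ^+ 2).
Proof.
have mOm := convex_polyhedral_measurable hOm.
have r0 : 0 < rho0^-1 by rewrite invr_gt0.
exists (expR (2 * T) * (1 + rho0^-1)).
  by rewrite mulr_gt0 ?expR_gt0// ltr_wpDr// ltW.
move=> f psi0 phi1 Cf _ _ i M M_gt0 dt1 sigma v _ _ [inH scheme] J /andP[_ JM].
set dt := T / M%:R in dt1 scheme *.
set fn := fun n => f (n%:R * dt) in scheme.
have [[VHh subH] [VVh subV]] := (hHh i, hVh i).
have Mp : 0 < M%:R :> R by rewrite ltr0n.
have dt0 : 0 < dt by rewrite divr_gt0.
have MT : M%:R * dt = T by rewrite /dt mulrC divfK// gt_eqF.
have Hs n : (n <= M)%N -> Hdiv Om (sigma n) by move=> /inH[/subH].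
have Lv n : (n <= M)%N -> L2 Om (v n) by move=> /inH[_ /subV].
have tT n : (n <= M)%N -> 0 <= n%:R * dt <= T.
  by move=> nM; rewrite mulr_ge0 ?ler0n ?(ltW dt0)//= -MT ler_pM2r// ler_nat.
have Lf n : (n <= M)%N -> L2 Om (fn n) by move=> /tT; apply: Cf.1.
set F := Linf_L2_norm Om T f.
have fF n : (n <= M)%N -> L2norm Om (fn n) ^+ 2 <= F ^+ 2.
  move=> nM; have le := L2norm_le_Linf mOm hT Cf (tT n nM).
  rewrite lerXn2r// nnegrE ?L2norm_ge0//; apply: le_trans le; exact: L2norm_ge0.
pose E n := norm_c Om rho (v n) ^+ 2 + norm_a Om C (sigma n) ^+ 2.
have E0 n : 0 <= E n by rewrite addr_ge0 ?sqr_ge0.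
pose G := rho0^-1 * F ^+ 2.
have G0 : 0 <= G by rewrite mulr_ge0 ?sqr_ge0// ltW.
have step n : (n < M)%N -> E n.+1 - E n <= dt * ((E n + E n.+1) / 2 + G).
  move=> nM; have nM' := ltnW nM.
  have [[Hn Vn] [Hn1 Vn1]] := (inH n nM', inH n.+1 nM).
  have [Hsn Hsn1] := (Hs n nM', Hs n.+1 nM).
  have [Lvn Lvn1] := (Lv n nM', Lv n.+1 nM).
  have Hmid := findim_midpoint VHh Hn Hn1.
  have Vmid := findim_midpoint VVh Vn Vn1.
  have [/(_ _ Hmid) eqa /(_ _ Vmid) eqc] := scheme n nM.
  rewrite (form_a_diffquot mOm hM0 mC symC hC)// in eqa.
  rewrite (form_c_diffquot mOm hrho0 mrho hrho)// in eqc.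
  have aa_ge0 := form_a_ge0 mOm hM0 mC symC hC (subH _ Hmid).
  have load := L2dot_midpoint_le mOm hrho0 mrho hrho
    (Lf _ nM') (Lf _ nM) Lvn Lvn1.
  have loadF : rho0^-1 *
      ((L2norm Om (fn n) ^+ 2 + L2norm Om (fn n.+1) ^+ 2) / 2) <= G.
    by rewrite ler_pM2l// ler_pdivrMr// mulr_natr mulr2n lerD// fF.
  rewrite /E !(norm_c_sqr mOm hrho0 mrho hrho)//.
  rewrite !(norm_a_sqr mOm hM0 mC symC hC)//.
  have a0 := form_a_ge0 mOm hM0 mC symC hC Hsn.
  have a1 := form_a_ge0 mOm hM0 mC symC hC Hsn1.
  (* Multiply both tested equations by 2 dt and add them: form_b drops out. *)
  have gap0 : 2 * dt != 0 by rewrite mulf_neq0 ?pnatr_eq0// gt_eqF.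
  move/(congr1 ( *%R (2 * dt))): eqa; rewrite 2!mulrDr mulVKf// mulr0.
  move/(congr1 ( *%R (2 * dt))): eqc; rewrite mulrBr mulVKf//.
  have := ler_wpM2l (ltW dt0) load; have := ler_wpM2l (ltW dt0) loadF.
  have := mulr_ge0 (ltW dt0) aa_ge0.
  have := mulr_ge0 (ltW dt0) (addr_ge0 a0 a1).
  clear; lra.
have := crank_nicolson_gronwall dt0 dt1 _ G0 (fun n _ => E0 n) step JM.
rewrite MT => /(_ _ (lexx T)) bound.
rewrite -/(E J) -mulrA; apply: (@le_trans _ _ (E J + G)); first by rewrite lerDl.
apply: le_trans bound _; rewrite ler_pM2l ?expR_gt0//.
rewrite (addrC (norm_a _ _ _ ^+ 2)) -/(E 0%N) /G.
have := mulr_ge0 (ltW r0) (E0 0%N); have := sqr_ge0 F.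
by move: (E 0%N) => e0; clear; lra.
Qed.
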